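(* Let $p$ be a prime. For integers $n\ge1$, $\mu\ge1$, let $P(n,p^\mu)$ be the probability that a random symmetric $n\times n$ matrix over $\mathbf{Z}_{p^\mu}$ has determinant $\not\equiv 0\pmod{p^\mu}$, and extend this by the conventions $P(0,p^\mu)=1$ for $\mu>0$ and $P(n,p^\mu)=0$ for $\mu\le0$ (all $n\ge0$). Then for all $n\ge 0$ and $\mu\ge 0$, $$P(n+1,p^\mu)\le P(n,p^\mu)\le P(n,p^{\mu+1}).$$
   Context: For a positive integer $m$, $\mathbf{Z}_m=\{1,2,\ldots,m\}$ (viewed as residues mod $m$). A random symmetric $n\times n$ matrix over $\mathbf{Z}_m$ is one whose entries $a_{ij}$, $i\le j$, are chosen independently and uniformly from $\mathbf{Z}_m$, with $a_{ji}=a_{ij}$. *)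

(* Defs.v *)
From HB Require Import structures.
From mathcomp Require Import all_boot all_order all_algebra.
Set Implicit Arguments. Unset Strict Implicit. Unset Printing Implicit Defensive.
Import Order.TTheory GRing.Theory Num.Theory.
Local Open Scope ring_scope.

(* Symmetric n x n matrices over Z/mZ (m = p^mu >= 2 when p prime, mu >= 1).
   'Z_(p^mu) is the ring Z/p^mu Z in that case. *)
Definition sym_mats (m n : nat) : {set 'M['Z_m]_n} :=
  [set A : 'M['Z_m]_n | A^T == A].

Definition sym_nonsing (m n : nat) : {set 'M['Z_m]_n} :=
  [set A : 'M['Z_m]_n | (A^T == A) && (\det A != 0)].

(* P(n, p^mu): probability that a uniformly random symmetric n x n matrix over
   Z_(p^mu) (entries a_ij, i <= j, independent uniform; equivalently uniform on
   the set of symmetric matrices) has determinant nonzero mod p^mu, with the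
   conventions P(n, p^0) = 0 and P(0, p^mu) = 1 for mu > 0. *)
Definition Psym (p n mu : nat) : rat :=
  if mu == 0%N then 0
  else if n == 0%N then 1
  else (#|sym_nonsing (p ^ mu) n|%:R / #|sym_mats (p ^ mu) n|%:R).

(* Main.v *)
Require Import Defs.
From HB Require Import structures.
From mathcomp Require Import all_boot all_order all_algebra.
From mathcomp Require Import perm ring lra.
Import Order.TTheory GRing.Theory Num.Theory.
Local Open Scope ring_scope.
Set Implicit Arguments. Unset Strict Implicit. Unset Printing Implicit Defensive.

(** Work over the local ring R = Z/p^N with N > mu, where P(n, p^e) is the
probability that p^e does not divide the determinant of a random symmetric
matrix; this is monotone in e.  For monotonicity in n, let G(n, k) be the same
probability for the random symmetric matrices of size n + k whose entries are
uniform in an n x n principal block and uniform multiples of p elsewhere.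
Eliminating a 1 x 1 or a 2 x 2 unit pivot from a row of the free block gives,
with q = 1/p,
  G(n+1, k) = (1-q) G(n, k) + (q - q^(n+1)) G(n-1, k) + q^(n+1) G(n, k+1),
while G(0, k) = P(k, p^(e-k)) is nonincreasing in k by induction on e.  So
G(n, 0) is the mean of the nonincreasing function g = G(0, _) at the corank of
a random symmetric n x n matrix over F_p.  That corank is also a Markov chain
in n, obtained by bordering: from s it moves to s-1, s, s+1 with probabilities
1 - q^s, q^s (1-q), q^(s+1).  This kernel preserves nonincreasing functions
and the chain starts at its minimum 0, so G(n+1, 0) <= G(n, 0). *)

(** * The corank recursion and its bordering kernel *)

Section CorankChain.
Variables (K : realFieldType) (q : K).

(** For q = 1/p this is the mean of g (k + s), where s is the corank of a random symmetric n x n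
    matrix over F_p. For n = 1 the middle term is absent, in accordance with its coefficient q - q^1
    = 0. *)
Fixpoint corank_sum (n : nat) (g : nat -> K) (k : nat) : K :=
  match n with
  | 0 => g k
  | n'.+1 => (1 - q) * corank_sum n' g k
      + match n' with
        | 0 => 0
        | n''.+1 => (q - q ^+ n) * corank_sum n'' g k
        end
      + q ^+ n * corank_sum n' g k.+1
  end.

(** At s = 0 the truncated predecessor has weight 1 - q^0 = 0. *)
Definition border_step (g : nat -> K) (s : nat) : K :=
  (1 - q ^+ s) * g s.-1 + q ^+ s * (1 - q) * g s + q ^+ s.+1 * g s.+1.

Lemma corank_sum1 g k : corank_sum 1 g k = (1 - q) * g k + q * g k.+1.
Proof. by rewrite /= addr0 expr1. Qed.

Lemma corank_sumSS n g k : corank_sum n.+2 g k =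
  (1 - q) * corank_sum n.+1 g k + (q - q ^+ n.+2) * corank_sum n g k
  + q ^+ n.+2 * corank_sum n.+1 g k.+1.
Proof. by []. Qed.

Lemma nat_ind2 (P : nat -> Prop) :
  P 0 -> P 1 -> (forall n, P n -> P n.+1 -> P n.+2) -> forall n, P n.
Proof.
by move=> P0 P1 PS n; suff [] : P n /\ P n.+1; elim: n => // n [? ?]; auto.
Qed.

Lemma corank_sum_lin n (a b : K) (f g h : nat -> K) :
  (forall k, f k = a * g k + b * h k) ->
  forall k, corank_sum n f k = a * corank_sum n g k + b * corank_sum n h k.
Proof.
move=> E; elim/nat_ind2: n => [|k|n IH0 IH1 k]; first exact: E.
  by rewrite !corank_sum1 !E; ring.
by rewrite !corank_sumSS !IH1 !IH0; ring.
Qed.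

Lemma corank_sum_shift n (g : nat -> K) k :
  corank_sum n (fun s => g s.+1) k = corank_sum n g k.+1.
Proof.
elim/nat_ind2: n k => [||n IH0 IH1] k //.
by rewrite !corank_sumSS !IH1 !IH0.
Qed.

(** Since 1 - q^(s+1) = (1 - q) + q (1 - q^s), a step from s+1 is a mixture: with weight 1 - q go
    down to s, with weight q make a step from s raised by one. *)
Lemma border_step_shift (g : nat -> K) s :
  border_step g s.+1 = (1 - q) * g s + q * border_step (fun s => g s.+1) s.
Proof.
rewrite /border_step; case: s => [|s] /=; rewrite !exprS ?expr0; ring.
Qed.

(* The recursion defining [corank_sum] and the bordering kernel describe the same
   law; they are reconciled by the commutation relation [border_step_shift]
   between the kernel and the shift. *)
Lemma corank_sumS0 n (g : nat -> K) :
  corank_sum n.+1 g 0 = corank_sum n (border_step g) 0.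
Proof.
elim/nat_ind2: n g => [|| n IH0 IH1] g.
- by rewrite corank_sum1 /border_step /= expr0 expr1; ring.
- rewrite corank_sumSS !corank_sum1 /= /border_step !exprS expr0 /=; ring.
have E : corank_sum n.+1 (border_step g) 1 = (1 - q) * corank_sum n (border_step g) 0
    + q * corank_sum n.+2 g 1.
  rewrite -[LHS]corank_sum_shift -(corank_sum_shift n.+2) IH1 -IH0.
  exact: corank_sum_lin (border_step_shift g) 0.
by rewrite !corank_sumSS E -IH0 -IH1 !corank_sumSS !exprS; ring.
Qed.

Hypothesis (q_ge0 : 0 <= q) (q_le1 : q <= 1).

(** The kernel is stochastically monotone. From s and from s+1 it reaches values at most s with the
    same weight 1 - q^(s+1), so the increment between g s and g (s+1) drops out of the difference
    and the other two have nonnegative weights. *)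
Lemma border_step_noninc (g : nat -> K) :
  (forall s, g s.+1 <= g s) -> forall s, border_step g s.+1 <= border_step g s.
Proof.
move=> g_dec s; rewrite -subr_ge0.
have g_pred : 0 <= g s.-1 - g s by case: s => [|s] /=; rewrite subr_ge0.
have -> : border_step g s - border_step g s.+1
    = (1 - q ^+ s) * (g s.-1 - g s) + q ^+ s.+2 * (g s.+1 - g s.+2).
  by rewrite /border_step /= !exprS; ring.
by apply: addr_ge0; apply: mulr_ge0;
  rewrite ?exprn_ge0 ?subr_ge0 ?exprn_ile1 // -subr_ge0.
Qed.

(** One transition of the chain is absorbed into g, and the induction hypothesis is used for
    [border_step g]. The base case compares g 0 with (1 - q) g 0 + q g 1. *)
Lemma corank_sum_noninc n (g : nat -> K) : (forall s, g s.+1 <= g s) ->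
  corank_sum n.+1 g 0 <= corank_sum n g 0.
Proof.
elim: n g => [|n IHn] g g_dec; last first.
  by rewrite !(corank_sumS0 _ g) IHn //; exact: border_step_noninc.
have := ler_wpM2l q_ge0 (g_dec 0%N); rewrite corank_sum1 /= => ?; lra.
Qed.
End CorankChain.

(** * Additive maps send uniform elements to uniform elements *)

Section Fibers.
Variables (U V : finZmodType) (h : U -> V) (D : {set U}).
Hypothesis DB : {in D &, forall x y, x - y \in D}.
Hypothesis hB : {in D &, {morph h : x y / x - y}}.

Lemma card_fiber y : y \in h @: D ->
  #|[set x in D | h x == y]| = #|[set x in D | h x == 0]|.
Proof.
move=> /imsetP[x0 x0D ->]; rewrite -[RHS](card_imset _ (addIr x0)).
(* Only closure under differences is assumed, so - x0 is written as a double difference. *)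
have Nx0 : x0 - x0 - x0 \in D by rewrite !DB.
apply: eq_card => x; apply/idP/imsetP => [|[z]].
  rewrite inE => /andP[xD /eqP hx].
  by exists (x - x0); rewrite ?subrK // inE DB // hB // hx subrr eqxx.
rewrite inE => /andP[zD /eqP hz ->].
have -> : z + x0 = z - (x0 - x0 - x0) by rewrite subrr sub0r opprK.
by rewrite inE DB // !hB ?DB // hz subrr !sub0r opprK eqxx.
Qed.

(** All fibers have the size of the kernel, so the mean of f (h x) over D is the mean of f over the
    image; the two means are cross-multiplied. *)
Lemma sum_fibers (K : comNzRingType) (f : V -> K) :
  (\sum_(x in D) f (h x)) * #|h @: D|%:R = (\sum_(y in h @: D) f y) * #|D|%:R.
Proof.
pose k := #|[set x in D | h x == 0]|.
have E (g : V -> K) : \sum_(x in D) g (h x) = (\sum_(y in h @: D) g y) * k%:R.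
  rewrite (partition_big_imset h) mulr_suml; apply: eq_bigr => y yD.
  rewrite (eq_bigr (fun=> g y)); last by move=> x /andP[_ /eqP->].
  rewrite sumr_const mulr_natr /k -(card_fiber yD); congr (_ *+ _).
  by apply: eq_card => x; rewrite !inE.
have := E (fun=> 1); rewrite !sumr_const => ->.
by rewrite E -mulrA [_ * k%:R]mulrC.
Qed.
End Fibers.

Lemma sum_indicator (I : finType) (A : {set I}) (P : pred I) :
  #|[set i in A | P i]|%:R = \sum_(i in A) (P i)%:R :> rat.
Proof.
rewrite -sumr_const big_mkcond [RHS]big_mkcond; apply: eq_bigr => i _.
by rewrite inE; case: (i \in A); case: (P i).
Qed.

Local Notation free n := (fun i : nat => (i < n)%N).

(** * Symmetric matrices over a finite local ring and their Schur complements *)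

Section LocalRing.
Variable R : finComUnitRingType.
Hypothesis nonunitD : forall x y : R,
  x \isn't a GRing.unit -> y \isn't a GRing.unit -> x + y \isn't a GRing.unit.

Lemma nonunitB (x y : R) :
  x \isn't a GRing.unit -> y \isn't a GRing.unit -> x - y \isn't a GRing.unit.
Proof. by move=> nx ny; rewrite nonunitD // unitrN. Qed.

Lemma nonunit0 : (0 : R) \isn't a GRing.unit. Proof. by rewrite unitr0. Qed.

Implicit Types (m n r : nat) (F : pred nat).

(* Uniform on this set means: the entries (i, j) with F i and F j are uniform in R,
   the others uniform in the maximal ideal. *)
Definition psym m (F : pred nat) : {set 'M[R]_m} :=
  [set A : 'M[R]_m | (A^T == A) &&
    [forall i : 'I_m, [forall j : 'I_m, (F i && F j) || (A i j \isn't a GRing.unit)]]].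

Lemma psymP m F (A : 'M[R]_m) : reflect
  (A^T = A /\ forall i j : 'I_m, ~~ (F i && F j) -> A i j \isn't a GRing.unit)
  (A \in psym m F).
Proof.
rewrite inE; apply: (iffP andP) => [[/eqP AT H]|[AT H]]; split; rewrite ?AT //.
  by move=> i j /negPf Fij; move/forallP/(_ i)/forallP/(_ j): H; rewrite Fij.
by apply/forallP=> i; apply/forallP=> j; case: (boolP (_ && _)) => //= /H.
Qed.

Lemma psymB m F : {in psym m F &, forall A B, A - B \in psym m F}.
Proof.
move=> A B /psymP[AT HA] /psymP[BT HB]; apply/psymP; rewrite linearB /= AT BT.
by split=> // i j Fij; rewrite !mxE nonunitB ?HA ?HB.
Qed.

Lemma psym0 m F : 0 \in psym m F.
Proof. by apply/psymP; split=> [|i j _]; rewrite ?trmx0 // mxE nonunit0. Qed.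

Lemma card_psym_neq0 m F : #|psym m F|%:R != 0 :> rat.
Proof. by rewrite pnatr_eq0 -lt0n; apply/card_gt0P; exists 0; exact: psym0. Qed.

Lemma sum_nonunit (I : finType) (P : pred I) (f : I -> R) :
  (forall i, P i -> f i \isn't a GRing.unit) -> \sum_(i | P i) f i \isn't a GRing.unit.
Proof. by move=> H; elim/big_rec: _ => [|i x /H ? ?]; rewrite ?unitr0 // nonunitD. Qed.

(** Each term of the (i, j) entry has a factor from column i and one from column j of C. If i or j
    is not in F, one of these factors is a nonunit. *)
Lemma psym_congr r m F (P : 'M[R]_r) (C : 'M[R]_(r, m)) : P^T = P ->
  (forall k i, ~~ F (val i) -> C k i \isn't a GRing.unit) -> C^T *m P *m C \in psym m F.
Proof.
move=> PT HC; apply/psymP; split=> [|i j]; first by rewrite !trmx_mul trmxK PT mulmxA.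
rewrite negb_and => Fij; rewrite mxE; apply: sum_nonunit => k _; rewrite unitrM.
case/orP: Fij => [Fi|/HC/negPf->]; rewrite ?andbF // negb_and; apply/orP; left.
by rewrite mxE; apply: sum_nonunit => l _; rewrite mxE unitrM negb_and HC.
Qed.

(** The lower right block is parametrized by its Schur complement W, which then serves as the
    summation variable. *)
Lemma det_schur r m (P : 'M[R]_r) (C : 'M[R]_(r, m)) (W : 'M[R]_m) : P \in unitmx ->
  \det (block_mx P C C^T (W + C^T *m invmx P *m C)) = \det P * \det W.
Proof.
move=> uP.
have -> : block_mx P C C^T (W + C^T *m invmx P *m C)
    = block_mx P 0 C^T 1%:M *m block_mx 1%:M (invmx P *m C) 0 W.
  rewrite mulmx_block !mulmx1 !mul1mx !mul0mx !addr0 mulKVmx //.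
  by rewrite [_ + W]addrC mulmxA.
by rewrite det_mulmx det_lblock det_ublock !det1 mulr1 mul1r.
Qed.

(** This lets the determinant of an invertible pivot block be discarded. *)
Definition unit_invariant (phi : R -> rat) :=
  forall u x, u \is a GRing.unit -> phi (u * x) = phi x.

(** With its first r rows fixed, A is determined by its lower right block. The correction term Q
    lies in the additive group [psym] of that block, so translation by Q is a bijection between
    Schur complements and admissible blocks. *)
Lemma sum_psym_border r m F phi (A0 : 'M[R]_(r + m)) : unit_invariant phi ->
    A0 \in psym (r + m) F -> ulsubmx A0 \in unitmx ->
  \sum_(A in psym (r + m) F | usubmx A == usubmx A0) phi (\det A) =
  \sum_(W in psym m (fun i => F (r + i)%N)) phi (\det W).
Proof.
move=> phi_inv /psymP[A0T HA0] uP.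
set P := ulsubmx A0 in uP *; pose C := ursubmx A0.
have PT : P^T = P by rewrite trmx_ulsub A0T.
have eqU (A : 'M_(r + m)) : A^T = A -> usubmx A = usubmx A0 ->
    A = block_mx P C C^T (drsubmx A).
  move=> AT EA; rewrite -{1}[A]submxK trmx_ursub A0T; congr block_mx.
  - by rewrite /ulsubmx EA.
  - by rewrite /ursubmx EA.
  - by rewrite -{1}AT -trmx_ursub /ursubmx EA -/(ursubmx A0) trmx_ursub A0T.
have HC k (i : 'I_m) : ~~ F (r + i)%N -> C k i \isn't a GRing.unit.
  by move=> Fi; rewrite !mxE HA0 //= negb_and Fi orbT.
have SC : C^T *m invmx P *m C \in psym m (fun i => F (r + i)%N).
  by apply: psym_congr; rewrite ?trmx_inv ?PT.
set Q := C^T *m invmx P *m C in SC.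
rewrite (reindex_onto (fun W => block_mx P C C^T (W + Q)) (fun A => drsubmx A - Q)) /=;
  last first.
  by move=> A /andP[/psymP[AT _] /eqP EA]; rewrite subrK -eqU.
apply: eq_big => [W|W _]; last by rewrite det_schur // phi_inv.
rewrite block_mxKdr addrK eqxx andbT block_mxEv col_mxKu.
have -> : (row_mx P C == usubmx A0) by apply/eqP; rewrite hsubmxK.
rewrite andbT -block_mxEv; apply/idP/idP.
  move=> /psymP[]; rewrite tr_block_mx trmxK => /eq_block_mx[_ _ _ WQT] HW.
  have : W + Q \in psym m (fun i => F (r + i)%N).
    by apply/psymP; split=> // i j; have := HW (rshift r i) (rshift r j);
    rewrite block_mxEdr.
  by move/psymB => /(_ _ SC); rewrite addrK.
move=> HW; have {HW} : W + Q \in psym m (fun i => F (r + i)%N).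
  rewrite -[Q]opprK -[- Q]sub0r; apply: psymB HW _; apply: psymB SC; exact: psym0.
move=> /psymP[WQT HWQ]; apply/psymP; rewrite tr_block_mx PT trmxK WQT; split=> // i j.
case: (split_ordP i) => i' ->; case: (split_ordP j) => j' -> Fij.
- by rewrite block_mxEul !mxE HA0.
- by rewrite block_mxEur !mxE HA0.
- by rewrite block_mxEdl 3!mxE HA0 // andbC.
- by rewrite block_mxEdr HWQ.
Qed.

(* Cross-multiplied form of: given that the first r rows satisfy h, the mean of
   [phi (\det A)] equals the mean of [phi (\det W)].  Taking the constant 1 for
   psi turns the sums of psi into cardinalities. *)
Lemma sum_psym_schur r m F (h : pred 'M[R]_(r, r + m)) phi psi :
    unit_invariant phi -> unit_invariant psi ->
    (forall A, A \in psym (r + m) F -> h (usubmx A) -> ulsubmx A \in unitmx) ->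
  (\sum_(A in psym (r + m) F | h (usubmx A)) phi (\det A)) *
    (\sum_(W in psym m (fun i => F (r + i)%N)) psi (\det W)) =
  (\sum_(A in psym (r + m) F | h (usubmx A)) psi (\det A)) *
    (\sum_(W in psym m (fun i => F (r + i)%N)) phi (\det W)).
Proof.
move=> phi_inv psi_inv hU.
pose X := [set A in psym (r + m) F | h (usubmx A)].
(* Every value of the first r rows allowed by h contributes the same sum over W, so the total is
   that sum times the number of such values. *)
have E f : unit_invariant f -> \sum_(A in psym (r + m) F | h (usubmx A)) f (\det A) =
   (\sum_(W in psym m (fun i => F (r + i)%N)) f (\det W)) *+ #|@usubmx _ r m _ @: X|.
  move=> f_inv; rewrite (eq_bigl (mem X)) => [|A]; last by rewrite !inE.
  rewrite (partition_big_imset usubmx) -sumr_const; apply: eq_bigr => _ /imsetP[A0 + ->].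
  rewrite inE => /andP[A0S hA0].
  rewrite -(sum_psym_border f_inv A0S) ?hU //; apply: eq_bigl => A.
  rewrite [A \in X]inE -andbA; case: (A \in psym _ _) => //=.
  by case: eqP => [->|_]; rewrite ?hA0 ?andbF.
by rewrite !E // !mulrnAl mulrC.
Qed.

Lemma det_mxsub_perm m (s : {perm 'I_m}) (A : 'M[R]_m) : \det (mxsub s s A) = \det A.
Proof.
have -> : mxsub s s A = perm_mx s *m A *m (perm_mx s)^T.
  by rewrite tr_perm_mx -row_permE -col_permE; apply/matrixP=> i j; rewrite !mxE.
by rewrite !det_mulmx det_tr mulrC mulrA det_perm -expr2 sqrr_sign mul1r.
Qed.

(** Permuting rows and columns simultaneously will move a 2 x 2 pivot to the leading position and
    move an index that is no longer free behind the free ones. *)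
Lemma sum_psym_perm m (s : {perm 'I_m}) F F' (h : pred 'M[R]_m) (phi : R -> rat) :
    (forall i : 'I_m, F' i = F (s i)) ->
  \sum_(A in psym m F' | h A) phi (\det A) =
  \sum_(A in psym m F | h (mxsub s s A)) phi (\det A).
Proof.
move=> EF.
have mxsubK (t : {perm 'I_m}) (A : 'M[R]_m) : mxsub t^-1%g t^-1%g (mxsub t t A) = A.
  by apply/matrixP=> i j; rewrite !mxE !permKV.
rewrite (reindex (mxsub s s)) /=; last first.
  exists (mxsub s^-1%g s^-1%g) => A _; first exact: mxsubK.
  by rewrite -{1 2}[s]invgK mxsubK.
apply: eq_big => [A|A _]; last by rewrite det_mxsub_perm.
congr (_ && _); apply/psymP/psymP => -[AT HA]; split.
- by rewrite -[A](mxsubK s) trmx_mxsub AT.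
- move=> i j Fij; have := HA (s^-1 i)%g (s^-1 j)%g.
  by rewrite !EF mxE !permKV; exact.
- by rewrite trmx_mxsub AT.
- by move=> i j; rewrite !EF mxE; apply: HA.
Qed.



(** * Classification by the pivot available in row 0 *)

Definition psym_sum (phi : R -> rat) m n : rat :=
  \sum_(A in psym m (free n)) phi (\det A).

Lemma psym_sum1 m n : psym_sum (fun=> 1) m n = #|psym m (free n)|%:R.
Proof. by rewrite /psym_sum sumr_const. Qed.

Lemma sum_pivot1 m n (phi psi : R -> rat) : unit_invariant phi -> unit_invariant psi ->
  (\sum_(A in psym m.+1 (free n.+1) | A 0 0 \is a GRing.unit)
     phi (\det A)) * psym_sum psi m n =
  (\sum_(A in psym m.+1 (free n.+1) | A 0 0 \is a GRing.unit)
     psi (\det A)) * psym_sum phi m n.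
Proof.
move=> phi_inv psi_inv.
pose h := fun U : 'M[R]_(1, 1 + m) => U 0 0 \is a GRing.unit.
have E A : h (@usubmx _ 1 m (1 + m) A) = (A 0 0 \is a GRing.unit).
  by rewrite /h mxE; congr (A _ _ \is a _); exact: val_inj.
have := @sum_psym_schur 1 m (free n.+1) h phi psi phi_inv psi_inv.
rewrite !(eq_bigl _ _ (fun A => congr1 (andb (A \in psym m.+1 (free n.+1))) (E A))).
apply=> A _; rewrite E unitmxE det_mx11 !mxE => uA.
by rewrite (_ : lshift m 0 = 0) //; exact: val_inj.
Qed.

Definition has_unit n m (v : 'rV[R]_m) : bool :=
  [exists j : 'I_m, (j < n)%N && (v 0 j \is a GRing.unit)].

(** By symmetry a01^2 = a00 a11 - det A, which would be a nonunit if det A were one. *)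
Lemma unit_det2 (A : 'M[R]_2) : A^T = A -> A 0 0 \isn't a GRing.unit ->
  A 0 1 \is a GRing.unit -> A \in unitmx.
Proof.
move=> AT nA0 uA1; rewrite unitmxE; apply: contraLR uA1 => ndet.
suff: A 0 1 * A 0 1 \isn't a GRing.unit by rewrite unitrM andbb.
have -> : A 0 1 * A 0 1 = A 0 0 * A 1 1 - \det A.
  rewrite (expand_det_row A 0) !big_ord_recl big_ord0 /cofactor !det_mx11 !mxE /=.
  have e1 (i : 'I_1) : lift (0 : 'I_2) i = 1 by rewrite ord1; exact: val_inj.
  have e0 : lift (1 : 'I_2) (0 : 'I_1) = 0 by exact: val_inj.
  rewrite !e1 !e0 (_ : A 1 0 = A 0 1); last by rewrite -{1}AT mxE.
  rewrite (_ : ord0 = 0 :> 'I_2); last exact: val_inj.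
  rewrite -[bump 0 0]/1%N add0n expr0 expr1; ring.
by apply: nonunitB ndet; rewrite unitrM (negPf nA0).
Qed.

(** The position j of a unit depends on row 0, so that whole row is fixed first. Swapping 1 and j,
    both below n+2, preserves [free n.+2] and makes the leading 2 x 2 block invertible. *)
Lemma sum_pivot2_row m n (v : 'rV[R]_m.+2) (phi psi : R -> rat) :
    unit_invariant phi -> unit_invariant psi ->
    v 0 0 \isn't a GRing.unit -> has_unit n.+2 v ->
  (\sum_(A in psym m.+2 (free n.+2) | row 0 A == v) phi (\det A)) * psym_sum psi m n =
  (\sum_(A in psym m.+2 (free n.+2) | row 0 A == v) psi (\det A)) * psym_sum phi m n.
Proof.
move=> phi_inv psi_inv nv0 /existsP[j /andP[jn uvj]].
have j_neq0 : j != 0 by apply: contraNneq nv0 => <-.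
pose s := tperm 1 j.
have s0 : s 0 = 0 by rewrite tpermD // eq_sym.
have sF (i : 'I_m.+2) : (i < n.+2)%N = (s i < n.+2)%N.
  by rewrite /s; case: tpermP => [->|->|].
pose h := fun U : 'M[R]_(2, 2 + m) => [forall i, U 0 (s i) == v 0 i].
have E A : h (@usubmx _ 2 m (2 + m) A) = (row 0 (mxsub s s A) == v).
  apply/forallP/eqP => [H|<- i].
    apply/rowP=> i; rewrite !mxE s0 -(eqP (H i)) mxE; congr (A _ _).
    exact: val_inj.
  by rewrite !mxE s0; apply/eqP; congr (A _ _); exact: val_inj.
have S f : \sum_(A in psym m.+2 (free n.+2) | row 0 A == v) f (\det A) =
    \sum_(A in psym (2 + m) (free n.+2) | h (usubmx A)) f (\det A) :> rat.
  rewrite (sum_psym_perm (F := free n.+2) (F' := free n.+2) (fun A => row 0 A == v) f sF).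
  apply: eq_bigl => A; by rewrite E.
rewrite !S; apply: (@sum_psym_schur 2 m (free n.+2)) => // A.
move=> /psymP[AT _]; rewrite E => /eqP Av.
have Av' i : A 0 (s i) = v 0 i by rewrite -Av !mxE s0.
apply: unit_det2; first by rewrite trmx_ulsub AT.
  rewrite !mxE; move: nv0; rewrite -Av' s0.
  by rewrite (_ : lshift m 0 = 0) //; exact: val_inj.
rewrite !mxE; move: uvj; rewrite -Av' tpermR.
rewrite (_ : lshift m 0 = 0); last exact: val_inj.
by rewrite (_ : lshift m 1 = 1) //; exact: val_inj.
Qed.

(* A nonunit corner next to a unit v_j (j < n): rows 0 and j give a 2 x 2 unit pivot. *)
Definition pivot2 n m (v : 'rV[R]_m.+1) :=
  (v 0 0 \isn't a GRing.unit) && has_unit n v.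

Lemma sum_pivot2 m n (phi psi : R -> rat) :
    unit_invariant phi -> unit_invariant psi ->
  (\sum_(A in psym m.+2 (free n.+2) | pivot2 n.+2 (row 0 A))
     phi (\det A)) * psym_sum psi m n =
  (\sum_(A in psym m.+2 (free n.+2) | pivot2 n.+2 (row 0 A))
     psi (\det A)) * psym_sum phi m n.
Proof.
move=> phi_inv psi_inv.
have E f : \sum_(A in psym m.+2 (free n.+2) | pivot2 n.+2 (row 0 A)) f (\det A) =
    \sum_(v | pivot2 n.+2 v) \sum_(A in psym m.+2 (free n.+2) | row 0 A == v) f (\det A)
    :> rat.
  rewrite (partition_big (row 0) (@pivot2 n.+2 m.+1)) => [|A /andP[]//].
  apply: eq_bigr => v pv; apply: eq_bigl => A; rewrite -andbA; congr (_ && _).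
  by case: eqP => [->|_]; rewrite ?pv ?andbF.
rewrite !E !mulr_suml; apply: eq_bigr => v /andP[nv0 uv].
exact: sum_pivot2_row.
Qed.

(** Without a unit in its free columns, row 0 consists of nonunits, so index 0 stops being free.
    Swapping 0 and n carries the remaining free indices 1, ..., n to 0, ..., n-1. *)
Lemma sum_nonpivot m n (phi : R -> rat) : (n <= m)%N ->
  \sum_(A in psym m.+1 (free n.+1) | ~~ has_unit n.+1 (row 0 A)) phi (\det A) =
  psym_sum phi m.+1 n.
Proof.
move=> le_nm; have lt_nm : (n < m.+1)%N by [].
pose s := tperm 0 (Ordinal lt_nm).
pose F' := fun i : nat => (0 < i < n.+1)%N.
have sF (i : 'I_m.+1) : F' i = (s i < n)%N.
  rewrite /F' /s; case: tpermP => [->|->|/eqP i0 /eqP ni] /=; first by rewrite ltnn.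
    by rewrite ltnSn andbT.
  rewrite lt0n ltnS leq_eqVlt; move: i0 ni; rewrite -!val_eqE /= => i0 /negPf->.
  by rewrite i0.
have := sum_psym_perm (F := free n) (F' := F') xpredT phi sF.
rewrite /psym_sum [RHS](eq_bigl _ _ (fun A => andbT _)) => <-; apply: eq_bigl => A.
rewrite andbT; apply/andP/psymP => [[/psymP[AT HA] nA]|[AT HA]].
  have nA0 (i : 'I_m.+1) : A 0 i \isn't a GRing.unit.
    case: (ltnP i n.+1) => [lt_in|le_ni]; last by rewrite HA //= -leqNgt.
    by move/existsPn/(_ i): nA; rewrite lt_in mxE.
  split=> // i j; rewrite /F'.
  case: (eqVneq i 0) => [->|i0]; first by rewrite nA0.
  case: (eqVneq j 0) => [->|j0]; first by rewrite -AT mxE nA0.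
  by rewrite !lt0n -!val_eqE /= in i0 j0 *; rewrite i0 j0; apply: HA.
split.
  apply/psymP; split=> // i j Fij; apply: HA; apply: contra Fij.
  by move=> /andP[/andP[_ ->] /andP[_ ->]].
by apply/existsPn => i; rewrite mxE negb_and HA ?orbT.
Qed.

(** The inverse of the order of the residue field. *)
Definition nonunit_ratio : rat :=
  #|[set x : R | x \isn't a GRing.unit]|%:R / #|R|%:R.
Local Notation q := nonunit_ratio.

(** On the additive group X of matrices whose first j entries in row 0 are nonunits, the (0, j)
    entry is an additive map onto R, hence uniform. *)
Lemma card_row_nonunit_step m n (j : 'I_m.+1) : (j <= n)%N ->
  #|[set A in psym m.+1 (free n.+1) | ~~ has_unit j.+1 (row 0 A)]|%:R =
  q * #|[set A in psym m.+1 (free n.+1) | ~~ has_unit j (row 0 A)]|%:R.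
Proof.
move=> le_jn.
set X := [set A in psym m.+1 (free n.+1) | ~~ has_unit j (row 0 A)].
have inX A : (A \in X) = (A \in psym m.+1 (free n.+1)) && ~~ has_unit j (row 0 A).
  by rewrite in_set.
have has_unitPn k (A : 'M[R]_m.+1) : reflect
    (forall i : 'I_m.+1, (i < k)%N -> A 0 i \isn't a GRing.unit)
    (~~ has_unit k (row 0 A)).
  apply: (iffP existsPn) => [H i ik|H i]; first by have := H i; rewrite ik mxE.
  by rewrite negb_and -implybE mxE; apply/implyP => /H.
have XB : {in X &, forall A B, A - B \in X}.
  move=> A B; rewrite !inX => /andP[SA /has_unitPn HA] /andP[SB /has_unitPn HB].
  have := psymB SA SB; move=> ->.
  by apply/has_unitPn => i ij; rewrite !mxE nonunitB ?HA ?HB.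
have imX : (fun A : 'M[R]_m.+1 => A 0 j) @: X = [set: R].
  apply/setP=> x; rewrite inE; apply/imsetP.
  (* Surjectivity: x at (0, j) and (j, 0), zero elsewhere; these positions are free because j <=
     n. *)
  pose E : 'M[R]_m.+1 := \matrix_(i, k)
    if ((i == 0) && (k == j)) || ((i == j) && (k == 0)) then x else 0.
  exists E; last by rewrite mxE !eqxx.
  rewrite inX; apply/andP; split; [apply/psymP; split|apply/has_unitPn].
  - by apply/matrixP=> i k; rewrite !mxE orbC [in X in X || _]andbC [in X in _ || X]andbC.
  - move=> i k Fik; rewrite mxE; case: ifP => [|_]; last by rewrite unitr0.
    have le_jn' : (j < n.+1)%N by [].
    by case/orP=> /andP[/eqP ei /eqP ek]; rewrite ei ek /= le_jn' in Fik.
  - move=> i ij; rewrite mxE; case: ifP => [|_]; last by rewrite unitr0.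
    case/orP=> /andP[/eqP ei /eqP ek].
      by rewrite ek ltnn in ij.
    by rewrite ek -ei ltnn in ij.
have hB : {in X &, {morph (fun A : 'M[R]_m.+1 => A 0 j) : x y / x - y}}.
  by move=> A B _ _; rewrite !mxE.
have := sum_fibers XB hB (fun x : R => (x \isn't a GRing.unit)%:R : rat).
rewrite imX -!sum_indicator cardsT /q.
have -> : [set x in [set: R] | x \isn't a GRing.unit] = [set x | x \isn't a GRing.unit].
  by apply/setP=> x; rewrite !inE.
have -> : [set A in X | A 0 j \isn't a GRing.unit]
    = [set A in psym m.+1 (free n.+1) | ~~ has_unit j.+1 (row 0 A)].
  apply/setP=> A; rewrite [LHS]in_set [RHS]in_set inX -andbA; congr (_ && _).
  apply/andP/has_unitPn => [[/has_unitPn H nj] i|H].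
    by rewrite ltnS leq_eqVlt => /orP[/eqP/val_inj->|/H].
  by split; [apply/has_unitPn => i ij; apply: H; exact: ltnW | apply: H].
have R_neq0 : #|R|%:R != 0 :> rat by rewrite pnatr_eq0 -lt0n; apply/card_gt0P; exists 0.
by move=> E; apply: (mulIf R_neq0); rewrite E; field.
Qed.

Lemma has_unit1 m (v : 'rV[R]_m.+1) : has_unit 1 v = (v 0 0 \is a GRing.unit).
Proof.
apply/existsP/idP => [[j /andP[]]|u0]; last by exists 0.
by rewrite ltnS leqn0 => /eqP j0; rewrite (_ : j = 0) //; exact: val_inj.
Qed.

Lemma card_row_nonunit m n j : (j <= n.+1)%N -> (n <= m)%N ->
  #|[set A in psym m.+1 (free n.+1) | ~~ has_unit j (row 0 A)]|%:R =
  q ^+ j * #|psym m.+1 (free n.+1)|%:R.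
Proof.
move=> + le_nm; elim: j => [_|j IHj lt_jn].
  rewrite mul1r; congr (_%:R); apply: eq_card => A; rewrite in_set.
  by rewrite (_ : has_unit 0 _ = false) ?andbT //; apply/negbTE/existsPn.
have lt_jm : (j < m.+1)%N by rewrite ltnS (leq_trans _ le_nm).
rewrite (card_row_nonunit_step (j := Ordinal lt_jm)) //= IHj; last exact: ltnW.
by rewrite exprS mulrA.
Qed.

Lemma psym_sum_split m n (phi : R -> rat) : psym_sum phi m.+1 n.+1 =
  \sum_(A in psym m.+1 (free n.+1) | A 0 0 \is a GRing.unit) phi (\det A)
  + \sum_(A in psym m.+1 (free n.+1) | pivot2 n.+1 (row 0 A)) phi (\det A)
  + \sum_(A in psym m.+1 (free n.+1) | ~~ has_unit n.+1 (row 0 A)) phi (\det A).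
Proof.
rewrite /psym_sum (bigID (fun A : 'M_m.+1 => A 0 0 \is a GRing.unit)) /= -addrA.
congr (_ + _); rewrite (bigID (fun A : 'M_m.+1 => has_unit n.+1 (row 0 A))) /=.
congr (_ + _); apply: eq_bigl => A; rewrite -andbA; congr (_ && _).
  by rewrite /pivot2 mxE.
apply: andb_idl; apply: contra => uA; apply/existsP; exists 0.
by rewrite mxE uA.
Qed.

(** * Averages over the three pivot classes *)

Definition psym_avg (phi : R -> rat) m n : rat :=
  psym_sum phi m n / psym_sum (fun _ : R => 1) m n.

(** The coefficients are the proportions of the three pivot classes, and each class has the average
    of a smaller or less free family. In the branch using [m.-1], n > 0 forces m > 0. *)
Lemma psym_avgS m n (phi : R -> rat) : unit_invariant phi -> (n <= m)%N ->
  psym_avg phi m.+1 n.+1 = (1 - q) * psym_avg phi m n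
    + match n with
      | 0 => 0
      | n'.+1 => (q - q ^+ n.+1) * psym_avg phi m.-1 n'
      end
    + q ^+ n.+1 * psym_avg phi m.+1 n.
Proof.
move=> phi_inv le_nm.
have inv1 : unit_invariant (fun _ : R => 1) by [].
have d_neq0 k l : psym_sum (fun _ : R => 1) k l != 0 by rewrite psym_sum1 card_psym_neq0.
pose d := psym_sum (fun _ : R => 1) m.+1 n.+1.
have Enon j : (j <= n.+1)%N ->
    \sum_(A in psym m.+1 (free n.+1) | ~~ has_unit j (row 0 A)) 1 = q ^+ j * d.
  move=> le_jn; rewrite /d psym_sum1 -card_row_nonunit // -sumr_const.
  by apply: eq_bigl => A; rewrite in_set.
have E1 : \sum_(A in psym m.+1 (free n.+1) | A 0 0 \is a GRing.unit) 1 = (1 - q) * d.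
  rewrite mulrBl mul1r -[q * d]/(q ^+ 1 * d) -Enon // {1}/d /psym_sum.
  rewrite [X in _ = X - _](bigID (fun A : 'M_m.+1 => ~~ has_unit 1 (row 0 A))) /=.
  rewrite addrAC subrr add0r.
  by apply: eq_bigl => A; rewrite negbK has_unit1 mxE.
have E3 := Enon n.+1 (leqnn _).
(* The proportion of the 2 x 2 class is what the other two leave. *)
have E2 : \sum_(A in psym m.+1 (free n.+1) | pivot2 n.+1 (row 0 A)) 1 =
    (q - q ^+ n.+1) * d.
  have := psym_sum_split m n (fun=> 1); rewrite E1 E3 -/d => E.
  apply: (addrI ((1 - q) * d)); apply: (addIr (q ^+ n.+1 * d)); rewrite -E; ring.
have := sum_pivot1 m n phi_inv inv1; rewrite E1.
move/(canRL (mulfK (d_neq0 m n))) => S1.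
have := sum_nonpivot (fun _ : R => 1) le_nm; rewrite E3 => S3.
have qn_neq0 : q ^+ n.+1 != 0.
  by apply: contraNneq (d_neq0 m.+1 n) => q0; rewrite -S3 q0 mul0r.
rewrite /psym_avg -S3 psym_sum_split S1 sum_nonpivot // -/d.
have d0 : d != 0 by exact: d_neq0.
clearbody d; clear Enon E1 E3 S1 S3.
(* For n = 0 the corner is the only free entry of row 0, so the 2 x 2 class is empty. *)
case: n le_nm E2 qn_neq0 => [|n] le_nm E2 qn_neq0.
  rewrite big_pred0 => [|A]; last by rewrite /pivot2 has_unit1 andNb andbF.
  by field; rewrite d_neq0 d0 qn_neq0.
case: m le_nm E2 => [|m] // le_nm E2 /=.
have := sum_pivot2 m n phi_inv inv1; rewrite E2.
move/(canRL (mulfK (d_neq0 m n))) => ->.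
by field; rewrite !d_neq0 d0 qn_neq0.
Qed.
(** In size n + k, [psym_avgS] is the recursion of [corank_sum]; its boundary values come from
    matrices with all entries in the maximal ideal. *)
Lemma psym_avg_corank_sum (phi : R -> rat) n k : unit_invariant phi ->
  psym_avg phi (n + k) n =
  corank_sum (nonunit_ratio) n (fun r => psym_avg phi r 0) k.
Proof.
move=> phi_inv; elim/nat_ind2: n k => [//|k|n IH0 IH1 k].
  by rewrite corank_sum1 addSn psym_avgS // addr0 expr1.
rewrite corank_sumSS -!IH1 -IH0 addnS [(n.+2 + k)%N]addSn psym_avgS ?leq_addr //.
Qed.
End LocalRing.

Lemma psym_avg_le (R : finComUnitRingType) (phi psi : R -> rat) m n :
  (forall x, phi x <= psi x) -> psym_avg phi m n <= psym_avg psi m n.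
Proof.
move=> le_phi; apply: ler_wpM2r; last exact: ler_sum.
by rewrite invr_ge0 psym_sum1 ler0n.
Qed.

Lemma psym_avg1 (R : finComUnitRingType) m n : psym_avg (fun _ : R => 1) m n = 1.
Proof. by rewrite /psym_avg divff // psym_sum1 card_psym_neq0. Qed.

(** * The ring Z/p^N and divisibility of determinants by p^e *)

Section PrimePower.
Variables (p N : nat).
Hypotheses (p_pr : prime p) (N_gt0 : (0 < N)%N).
Local Notation R := 'Z_(p ^ N).

Lemma prime_exp_gt1 e : (0 < e)%N -> (1 < p ^ e)%N.
Proof. by move=> e_gt0; rewrite -(exp1n e) ltn_exp2r // prime_gt1. Qed.
Let pN_gt1 := prime_exp_gt1 N_gt0.

Lemma dvdn_Zp_nat e a : (e <= N)%N -> (p ^ e %| (a%:R : R))%N = (p ^ e %| a)%N.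
Proof. by move=> le_eN; rewrite val_Zp_nat // /dvdn modn_dvdm // dvdn_exp2l. Qed.

Lemma dvdn_Zp_mul e (x y : R) : (e <= N)%N ->
  (p ^ e %| (x * y)%R)%N = (p ^ e %| (x : nat) * (y : nat))%N.
Proof. by move=> le_eN; rewrite -[RHS](dvdn_Zp_nat _ le_eN) natrM !natr_Zp. Qed.

Lemma dvdn_Zp_add e (x y : R) : (e <= N)%N ->
  (p ^ e %| (x + y)%R)%N = (p ^ e %| (x : nat) + (y : nat))%N.
Proof. by move=> le_eN; rewrite -[RHS](dvdn_Zp_nat _ le_eN) natrD !natr_Zp. Qed.

Lemma nonunit_Zp (x : R) : (x \isn't a GRing.unit) = (p %| x)%N.
Proof.
by rewrite -{1}(natr_Zp x) unitZpE // coprime_pexpl // prime_coprime // negbK.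
Qed.

Lemma dvdn_Zp_nat_prime a : (p %| (a%:R : R))%N = (p %| a)%N.
Proof. by have := dvdn_Zp_nat a N_gt0; rewrite expn1. Qed.

Lemma nonunitD_Zp (x y : R) :
  x \isn't a GRing.unit -> y \isn't a GRing.unit -> x + y \isn't a GRing.unit.
Proof.
rewrite !nonunit_Zp => px py.
by have := dvdn_Zp_add x y N_gt0; rewrite expn1 => ->; exact: dvdn_add.
Qed.

Lemma nonunit_ratio_Zp : nonunit_ratio R = p%:R^-1.
Proof.
have p_gt0 := prime_gt0 p_pr.
have ER : #|R| = (p ^ N)%N by rewrite card_ord Zp_cast.
have Eu : #|[set x : R | x \is a GRing.unit]| = totient (p ^ N).
  rewrite totient_count_coprime -[X in \sum_(0 <= _ < X) _](Zp_cast pN_gt1) big_mkord.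
  rewrite -sum1_card big_mkcond; apply: eq_bigr => x _.
  by rewrite inE -{1}(natr_Zp x) unitZpE //; case: coprime.
have := cardsC [set x : R | x \is a GRing.unit].
rewrite Eu ER totient_pfactor // => E.
rewrite /nonunit_ratio.
have -> : [set x : R | x \isn't a GRing.unit] = ~: [set x : R | x \is a GRing.unit].
  by apply/setP=> x; rewrite !inE.
have {}E : #|~: [set x : R | x \is a GRing.unit]| = (p ^ N.-1)%N.
  apply/eqP; rewrite -(eqn_add2l (p.-1 * p ^ N.-1)) E -mulSnr prednK // -expnS prednK //.
rewrite ER E -[in X in _ / X](prednK N_gt0) expnS natrM.
have p0 : p%:R != 0 :> rat by rewrite pnatr_eq0 -lt0n.
by rewrite !natrX; field; rewrite p0 expf_neq0.
Qed.

(** All exponents e <= N are treated in the single ring Z/p^N, so the induction on e never changes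
    the type of the matrices. *)
Definition ndvd_ind e (x : R) : rat := (~~ (p ^ e %| x)%N)%:R.

Lemma ndvd_ind_unit e : (e <= N)%N -> unit_invariant (ndvd_ind e).
Proof.
move=> le_eN u x uu; congr ((~~ _)%:R); rewrite dvdn_Zp_mul // Gauss_dvdr //.
by rewrite coprimeXl // prime_coprime // -nonunit_Zp uu.
Qed.

Lemma psym_free m : psym R m (free m) = [set A | A^T == A].
Proof.
apply/setP=> A; rewrite [RHS]inE; apply/psymP/eqP => [[]//|AT]; split=> // i j.
by rewrite !ltn_ord.
Qed.

(** Multiplication by p maps the symmetric matrices onto those with all entries divisible by p, and
    det (p A) = p^k det A. *)
Lemma psym_avg_scale e k : (e <= N)%N ->
  psym_avg (ndvd_ind e) k 0 = psym_avg (ndvd_ind (e - k)) k k.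
Proof.
move=> le_eN.
have hB : {in psym R k (free k) &, {morph (fun A => p%:R *: A) : A B / A - B}}.
  by move=> A B _ _; rewrite scalerBr.
have := sum_fibers (psymB nonunitD_Zp (F := free k)) hB
  (fun A => ndvd_ind e (\det A)).
have -> : [set p%:R *: A | A in psym R k (free k)] =
    psym R k (free 0).
  apply/setP=> B; apply/imsetP/psymP => [[A]|[BT HB']].
    rewrite psym_free inE => /eqP AT ->; split=> [|i j _]; first by rewrite linearZ /= AT.
    by rewrite mxE unitrM negb_and nonunit_Zp (dvdn_Zp_nat_prime p) dvdnn.
  exists (\matrix_(i, j) (B i j %/ p)%N%:R).
    by rewrite psym_free inE; apply/eqP/matrixP=> i j; rewrite !mxE -{1}BT mxE.
  apply/matrixP=> i j; rewrite !mxE -natrM mulnC divnK ?natr_Zp // -nonunit_Zp.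
  exact: HB'.
have -> : \sum_(A in psym R k (free k)) ndvd_ind e (\det (p%:R *: A)) =
    psym_sum (ndvd_ind (e - k)) k k.
  apply: eq_bigr => A _; congr ((~~ _)%:R); rewrite detZ -natrX.
  rewrite -[\det A]natr_Zp -natrM !dvdn_Zp_nat ?(leq_trans (leq_subr _ _) le_eN) //.
  have [le_ke|lt_ek] := leqP k e.
    by rewrite -{1}(subnKC le_ke) expnD dvdn_pmul2l // expn_gt0 prime_gt0.
  (* For k > e the truncated difference e - k is 0, and both divisibilities hold. *)
  have le_ek := ltnW lt_ek.
  by rewrite (eqP le_ek) expn0 dvd1n dvdn_mulr // dvdn_exp2l.
rewrite -!psym_sum1 -/(psym_sum _ k 0) => E.
rewrite /psym_avg; apply/eqP; rewrite eqr_div ?psym_sum1 ?card_psym_neq0 //.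
by rewrite -!psym_sum1 E.
Qed.

Lemma psym_avg_ndvd_ind00 e : (0 < e)%N -> psym_avg (ndvd_ind e) 0 0 = 1.
Proof.
move=> e_gt0; rewrite -[RHS](psym_avg1 R 0 0); congr (_ / _).
apply: eq_bigr => A _; rewrite det_mx00 /ndvd_ind (_ : (1 : R) = 1%N :> nat) ?dvdn1.
  by rewrite gtn_eqF // prime_exp_gt1.
by rewrite -[1]/(1%:R) val_Zp_nat // modn_small.
Qed.

Lemma psym_avg_ndvd_ind0 m n : psym_avg (ndvd_ind 0) m n = 0.
Proof.
by rewrite /psym_avg /psym_sum big1 ?mul0r // => A _; rewrite /ndvd_ind expn0 dvd1n.
Qed.

Lemma psym_avg_ndvd_ind_le e e' m n : (e <= e')%N ->
  psym_avg (ndvd_ind e) m n <= psym_avg (ndvd_ind e') m n.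
Proof.
move=> le_ee'; apply: psym_avg_le => x; rewrite ler_nat.
case: (boolP (p ^ e' %| x)%N) => [dvd_x|_]; last exact: leq_b1.
by rewrite (dvdn_trans (dvdn_exp2l p le_ee') dvd_x).
Qed.

(** Reduction modulo p^e maps symmetric matrices over Z/p^N onto those over Z/p^e and commutes with
    the determinant. The conventions agree too: p^0 divides everything, and the empty determinant 1
    is not divisible by p^e for e > 0. *)
Lemma Psym_psym_avg n e : (e <= N)%N -> Psym p n e = psym_avg (ndvd_ind e) n n.
Proof.
move=> le_eN; rewrite /Psym; case: (posnP e) => [->|e_gt0].
  by rewrite psym_avg_ndvd_ind0.
case: (posnP n) => [->|n_gt0]; first by rewrite psym_avg_ndvd_ind00.
have pe_gt1 := prime_exp_gt1 e_gt0.
pose rho (x : R) : 'Z_(p ^ e) := (x : nat)%:R.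
have rho_nat a : rho a%:R = a%:R.
  by apply: val_inj; rewrite /= !val_Zp_nat // modn_dvdm // dvdn_exp2l.
have rhoD x y : rho (x + y) = rho x + rho y.
  by rewrite -{1}[x]natr_Zp -{1}[y]natr_Zp -natrD rho_nat natrD.
have rhoB : GRing.zmod_morphism rho.
  by move=> x y; apply: (addIr (rho y)); rewrite -rhoD !subrK.
have rhoM : GRing.monoid_morphism rho.
  split=> [|x y]; first exact: (rho_nat 1%N).
  by rewrite -{1}[x]natr_Zp -{1}[y]natr_Zp -natrM rho_nat natrM.
pose f : {rmorphism R -> 'Z_(p ^ e)} := HB.pack rho
  (GRing.isZmodMorphism.Build _ _ rho rhoB) (GRing.isMonoidMorphism.Build _ _ rho rhoM).
have hB : {in psym R n (free n) &, {morph map_mx f : A B / A - B}}.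
  by move=> A B _ _; rewrite raddfB.
have := sum_fibers (psymB nonunitD_Zp (F := free n)) hB
  (fun A => (\det A != 0)%:R : rat).
have -> : [set map_mx f A | A in psym R n (free n)] = sym_mats (p ^ e) n.
  rewrite psym_free; apply/setP=> B; rewrite inE; apply/imsetP/eqP => [[A]|BT].
    by rewrite inE => /eqP AT ->; rewrite map_trmx AT.
  exists (map_mx (fun b : 'Z_(p ^ e) => (b : nat)%:R) B).
    by rewrite inE map_trmx BT.
  by apply/matrixP=> i j; rewrite !mxE [RHS]rho_nat natr_Zp.
have -> : \sum_(A in psym R n (free n)) (\det (map_mx f A) != 0)%:R =
    psym_sum (ndvd_ind e) n n.
  apply: eq_bigr => A _; rewrite det_map_mx /ndvd_ind; congr ((~~ _)%:R).
  by rewrite -val_eqE /= /rho val_Zp_nat.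
rewrite -sum_indicator (_ : [set _ in _ | _] = sym_nonsing (p ^ e) n); last first.
  by apply/setP=> B; rewrite !inE.
rewrite -psym_sum1 => E; apply/eqP; rewrite /psym_avg eqr_div ?E //.
  by rewrite pnatr_eq0 -lt0n; apply/card_gt0P; exists 0; rewrite inE trmx0.
by rewrite psym_sum1 card_psym_neq0.
Qed.

Lemma psym_avg_noninc e n : (e <= N)%N ->
  psym_avg (ndvd_ind e) n.+1 n.+1 <= psym_avg (ndvd_ind e) n n.
Proof.
elim/ltn_ind: e n => e IH n le_eN.
have inv := ndvd_ind_unit le_eN.
have := psym_avg_corank_sum nonunitD_Zp n.+1 0 inv.
have := psym_avg_corank_sum nonunitD_Zp n 0 inv.
rewrite !addn0 nonunit_ratio_Zp => -> ->; apply: corank_sum_noninc.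
- by rewrite invr_ge0 ler0n.
- by rewrite invf_le1 ?ltr0n ?ler1n prime_gt0.
move=> s; rewrite !psym_avg_scale //.
case: (posnP e) => [->|e_gt0]; first by rewrite !sub0n !psym_avg_ndvd_ind0.
(* At s = 0 the exponent does not drop, but the larger average is 1 because e > 0. *)
case: s => [|s].
  rewrite subn0 psym_avg_ndvd_ind00 // -(psym_avg1 R 1 1); apply: psym_avg_le => x.
  by rewrite lern1 leq_b1.
(* First raise the exponent from e-s-2 to e-s-1 in size s+2, then lower the size by the induction
   hypothesis at e-s-1 < e. *)
apply: le_trans (psym_avg_ndvd_ind_le _ _ (leq_sub2l _ (leqnSn _))) _.
apply: IH; last by rewrite (leq_trans (leq_subr _ _)).
by rewrite ltn_subrL e_gt0.
Qed.
End PrimePower.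

Theorem theorem5p3 (p : nat) (hp : prime p) (n mu : nat) :
  Psym p n.+1 mu <= Psym p n mu /\ Psym p n mu <= Psym p n mu.+1.
Proof.
(* With N = mu+1 > 0 both exponents mu and mu+1 live in the same ring, even for mu = 0. *)
rewrite !(@Psym_psym_avg p mu.+1) //; split.
  by apply: psym_avg_noninc.
by apply: psym_avg_ndvd_ind_le.
Qed.
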